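(* Let $(M,g)$ be a space-time with Ricci tensor $Ric$ and scalar curvature $s$, and let $T=Ric-\tfrac12 s\,g$ be the energy-momentum tensor given by the Einstein equations. Then the Einstein equations belong to the class $\Omega_1\oplus\Omega_2$, i.e. $g^{ij}\nabla_kT_{ij}=0$, if and only if the metric $g$ has constant scalar curvature.
   Context: A space-time $(M,g)$ is a smooth four-dimensional manifold $M$ with a metric $g$ of Lorentz signature $(-+++)$; $\nabla$ is its Levi-Civita connection. The curvature tensor is given by $R^k_{lij}X^l=\nabla_i\nabla_jX^k-\nabla_j\nabla_iX^k$, the Ricci tensor by $R_{ij}=R^k_{ikj}$, and the scalar curvature by $s=g^{ij}R_{ij}$. The Einstein equations are $R_{ij}-\tfrac12 s\,g_{ij}=T_{ij}$. The Einstein equations belong to the class $\Omega_1\oplus\Omega_2$ if $g^{ij}\nabla_kT_{ij}=0$ everywhere on $M$. Constant scalar curvature means $ds=0$ (i.e. $s$ is constant on each connected component of $M$). *)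

(* Defs.v *)
From mathcomp Require Import all_boot all_order all_algebra.
From mathcomp Require Import all_classical all_reals all_analysis.

Set Implicit Arguments.
Unset Strict Implicit.
Unset Printing Implicit Defensive.

Import Order.TTheory GRing.Theory Num.Theory.
Import numFieldNormedType.Exports.
Local Open Scope classical_set_scope.
Local Open Scope ring_scope.

Definition partial (R : realType) (n : nat) (i : 'I_n.+1)
    (f : 'rV[R]_n.+1 -> R) (x : 'rV[R]_n.+1) : R :=
  'D_(delta_mx 0 i) f x.

Fixpoint Ck_on (R : realType) (n : nat) (k : nat) (U : set 'rV[R]_n.+1)
    (f : 'rV[R]_n.+1 -> R) : Prop :=
  (forall x, U x -> {for x, continuous f}) /\
  match k with
  | 0 => True
  | k'.+1 => forall i : 'I_n.+1,
      (forall x, U x -> derivable f x (delta_mx 0 i)) /\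
      Ck_on k' U (partial i f)
  end.

Definition smooth_on (R : realType) (n : nat) (U : set 'rV[R]_n.+1)
    (f : 'rV[R]_n.+1 -> R) : Prop :=
  forall k : nat, Ck_on k U f.

(* Coordinate charts with values in R^4. The maps are total functions; only
   their values on the domain, resp. on the image of the domain, matter. *)
Record chart (R : realType) (M : topologicalType) := Chart {
  chart_dom : set M;
  chart_map : M -> 'rV[R]_4;
  chart_inv : 'rV[R]_4 -> M;
  chart_dom_open : open chart_dom;
  chart_img_open : open (chart_map @` chart_dom);
  chart_mapK : forall p, chart_dom p -> chart_inv (chart_map p) = p;
  chart_map_continuous : {within chart_dom, continuous chart_map};
  chart_inv_continuous : {within chart_map @` chart_dom, continuous chart_inv}
}.

Definition chart_img (R : realType) (M : topologicalType) (phi : chart R M)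
    : set 'rV[R]_4 :=
  chart_map phi @` chart_dom phi.

(* The coordinates of [phi] of the points that also lie in the domain
   of [psi]. *)
Definition overlap (R : realType) (M : topologicalType) (phi psi : chart R M)
    : set 'rV[R]_4 :=
  [set x | chart_img phi x /\ chart_dom psi (chart_inv phi x)].

Definition transition (R : realType) (M : topologicalType)
    (phi psi : chart R M) (x : 'rV[R]_4) : 'rV[R]_4 :=
  chart_map psi (chart_inv phi x).

Record smooth_manifold4 (R : realType) := SmoothManifold4 {
  carrier :> topologicalType;
  carrier_hausdorff : hausdorff_space carrier;
  carrier_second_countable : @second_countable carrier;
  atlas : set (chart R carrier);
  atlas_cover : forall p : carrier, exists2 phi, atlas phi & chart_dom phi p;
  atlas_smooth : forall phi psi, atlas phi -> atlas psi ->
    forall a : 'I_4, smooth_on (overlap phi psi)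
                       (fun x => transition phi psi x 0 a)
}.

Definition minkowski (R : realType) : 'M[R]_4 :=
  \matrix_(i, j) (if i == j then (if i == 0 then -1 else 1) else 0).

(* A symmetric bilinear form on R^4 with an orthonormal basis (the rows of P)
   of type (-+++). *)
Definition lorentz_signature (R : realType) (G : 'M[R]_4) : Prop :=
  G^T = G /\ exists2 P : 'M[R]_4, P \in unitmx & P *m G *m P^T = minkowski R.

(* The metric is given by its components [metric_comp phi x i j] = g_ij at the
   point with coordinates x in the chart phi; they are meaningful for phi in
   the atlas and x in the image of phi. *)
Record lorentz_metric (R : realType) (M : smooth_manifold4 R) := LorentzMetric {
  metric_comp : chart R M -> 'rV[R]_4 -> 'M[R]_4;
  metric_smooth : forall phi, atlas phi -> forall i j : 'I_4,
    smooth_on (chart_img phi) (fun x => metric_comp phi x i j);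
  metric_signature : forall phi, atlas phi -> forall x, chart_img phi x ->
    lorentz_signature (metric_comp phi x);
  metric_transform : forall phi psi, atlas phi -> atlas psi ->
    forall x, overlap phi psi x -> forall i j : 'I_4,
    metric_comp phi x i j =
    \sum_a \sum_b partial i (fun y => transition phi psi y 0 a) x *
                  partial j (fun y => transition phi psi y 0 b) x *
                  metric_comp psi (transition phi psi x) a b
}.

(* Index notation in a single coordinate system: [g] is the matrix of
   components of the metric as a function of the coordinates. Upper indices
   are listed before lower ones. *)
Section Coordinates.
Context {R : realType}.
Local Notation coords := 'rV[R]_4.
Implicit Types (g : coords -> 'M[R]_4) (x : coords) (i j k l m : 'I_4).

Definition inverse_metric g i j x : R := invmx (g x) i j.

(* Gamma^k_ij of the Levi-Civita connection *)
Definition christoffel g k i j x : R :=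
  2^-1 * \sum_l inverse_metric g k l x *
    (partial i (fun y => g y l j) x + partial j (fun y => g y i l) x
     - partial l (fun y => g y i j) x).

(* nabla_i X^k *)
Definition nabla_vector g (X : 'I_4 -> coords -> R) k i x : R :=
  partial i (X k) x + \sum_m christoffel g k i m x * X m x.

(* nabla_i S^k_j *)
Definition nabla_mixed g (S : 'I_4 -> 'I_4 -> coords -> R) k j i x : R :=
  partial i (S k j) x + \sum_m christoffel g k i m x * S m j x
                      - \sum_m christoffel g m i j x * S k m x.

(* nabla_k T_ij *)
Definition nabla_covariant g (T : 'I_4 -> 'I_4 -> coords -> R) k i j x : R :=
  partial k (T i j) x - \sum_m christoffel g m k i x * T m j x
                      - \sum_m christoffel g m k j x * T i m x.

(* nabla_i nabla_j X^k *)
Definition nabla2_vector g (X : 'I_4 -> coords -> R) k i j x : R :=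
  nabla_mixed g (nabla_vector g X) k j i x.

Definition coordinate_field l : 'I_4 -> coords -> R :=
  fun m _ => (m == l)%:R.

(* R^k_lij: the identity
   R^k_lij X^l = nabla_i nabla_j X^k - nabla_j nabla_i X^k
   read on X = d/dx^l. *)
Definition curvature g k l i j x : R :=
  nabla2_vector g (coordinate_field l) k i j x
  - nabla2_vector g (coordinate_field l) k j i x.

(* R_ij = R^k_ikj *)
Definition ricci g i j x : R := \sum_k curvature g k i k j x.

Definition scalar_curvature g x : R :=
  \sum_i \sum_j inverse_metric g i j x * ricci g i j x.

Definition energy_momentum g i j x : R :=
  ricci g i j x - 2^-1 * scalar_curvature g x * g x i j.

End Coordinates.

(* g^ij nabla_k T_ij = 0 everywhere on M: all components, in all charts. *)
Definition in_class_Omega1_Omega2 (R : realType) (M : smooth_manifold4 R)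
    (g : lorentz_metric M) : Prop :=
  forall phi, atlas phi -> forall x, chart_img phi x -> forall k : 'I_4,
  let gx := metric_comp g phi in
  \sum_i \sum_j inverse_metric gx i j x *
                nabla_covariant gx (energy_momentum gx) k i j x = 0.

(* ds = 0: all components of the differential of the scalar curvature vanish,
   in all charts. *)
Definition constant_scalar_curvature (R : realType) (M : smooth_manifold4 R)
    (g : lorentz_metric M) : Prop :=
  forall phi, atlas phi -> forall x, chart_img phi x -> forall k : 'I_4,
  partial k (scalar_curvature (metric_comp g phi)) x = 0.

(* Main.v *)
Require Import Defs.
From mathcomp Require Import all_boot all_order all_algebra.
From mathcomp Require Import all_classical all_reals all_analysis.
From mathcomp Require Import ring.

(** The Levi-Civita connection is metric, so contracting with the inverse
    metric commutes with covariant differentiation: in any chart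
    [g^ij nabla_k T_ij] is the partial derivative of the trace [g^ij T_ij].
    In dimension 4 the trace of [T = Ric - s/2 g] is [s - 4 s/2 = - s]. *)

Set Implicit Arguments.
Unset Strict Implicit.
Unset Printing Implicit Defensive.

Import Order.TTheory GRing.Theory Num.Theory.
Import numFieldNormedType.Exports.
Local Open Scope classical_set_scope.
Local Open Scope ring_scope.

(** * Calculus of smooth functions on an open set of coordinates *)

Section Smooth.
Context {R : realType} {n : nat}.
Local Notation coords := 'rV[R]_n.+1.
Implicit Types (U : set coords) (f h : coords -> R) (x : coords).

Lemma near_eq_open U f h x : open U -> U x -> (forall y, U y -> f y = h y) ->
  \forall y \near x, f y = h y.
Proof. by move=> oU Ux fh; apply: filterS fh _; apply: open_nbhs_nbhs. Qed.

(** A partial derivative depends only on the germ at [x]. This allows differentiating identities,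
    such as the symmetry of the metric, that are known only on the image of a chart. *)
Lemma eq_partial U f h i x : open U -> U x -> (forall y, U y -> f y = h y) ->
  partial i f x = partial i h x.
Proof.
by move=> oU Ux fh; apply: near_eq_derive; exact: near_eq_open oU Ux fh.
Qed.

Lemma continuous_eq_open U f h : open U -> (forall y, U y -> f y = h y) ->
  (forall x, U x -> {for x, continuous f}) ->
  forall x, U x -> {for x, continuous h}.
Proof.
move=> oU fh cf x Ux; have E := near_eq_open oU Ux fh.
rewrite /prop_for /continuous_at -fh//.
exact: cvg_trans (near_eq_cvg E) (cf x Ux).
Qed.

(** The Leibniz and quotient rules identify [partial i] of a product or an inverse only at points of
    [U], so the inductions on [k] below need regularity to be insensitive to values outside [U]. *)
Lemma Ck_on_eq k U f h : open U -> (forall y, U y -> f y = h y) ->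
  Ck_on k U f -> Ck_on k U h.
Proof.
move=> oU; elim: k f h => [|k IH] f h fh [cf df].
  by split=> //; exact: continuous_eq_open fh cf.
split.
  exact: continuous_eq_open fh cf.
move=> i; have [di Di] := df i; split.
  move=> x Ux; apply: near_eq_derivable (di x Ux).
  exact: near_eq_open oU Ux fh.
by apply: IH Di => y Uy; apply: eq_partial oU Uy fh.
Qed.

Lemma Ck_onS k U f : Ck_on k.+1 U f -> Ck_on k U f.
Proof.
elim: k f => [|k IH] f [cf df]; split=> // i.
by have [di Di] := df i; split => //; apply: IH.
Qed.

Lemma Ck_on_cst k U c : Ck_on k U (fun=> c).
Proof.
elim: k c => [|k IH] c; split=> //; try by move=> x _; exact: cst_continuous.
move=> i; split; first by move=> x _; apply: derivable_cst.
suff -> : partial i (fun=> c) = (fun=> 0) :> (coords -> R) by [].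
by apply/funext => x; exact: derive_cst.
Qed.

Lemma Ck_onD k U f h : open U -> Ck_on k U f -> Ck_on k U h ->
  Ck_on k U (fun x => f x + h x).
Proof.
move=> oU; elim: k f h => [|k IH] f h [cf df] [ch dh].
  by split=> // x Ux; apply: continuousD; [exact: cf|exact: ch].
split; first by move=> x Ux; apply: continuousD; [exact: cf|exact: ch].
move=> i; have [di Di] := df i; have [ei Ei] := dh i; split.
  by move=> x Ux; apply: derivableD; [exact: di|exact: ei].
apply: (Ck_on_eq oU _ (IH _ _ Di Ei)) => x Ux.
by rewrite /partial -deriveD//; [exact: di|exact: ei].
Qed.

(** Induction on the order: the derivative of the product contains [f] and [h] themselves next to
    their derivatives, hence the loss of one order through [Ck_onS]. *)
Lemma Ck_onM k U f h : open U -> Ck_on k U f -> Ck_on k U h ->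
  Ck_on k U (fun x => f x * h x).
Proof.
move=> oU; elim: k f h => [|k IH] f h sf sh; have [cf df] := sf;
    have [ch dh] := sh.
  by split=> // x Ux; apply: continuousM; [exact: cf|exact: ch].
split; first by move=> x Ux; apply: continuousM; [exact: cf|exact: ch].
move=> i; have [di Di] := df i; have [ei Ei] := dh i; split.
  by move=> x Ux; apply: derivableM; [exact: di|exact: ei].
have C := Ck_onD oU (IH _ _ (Ck_onS sf) Ei) (IH _ _ (Ck_onS sh) Di).
apply: (Ck_on_eq oU _ C) => x Ux.
exact: esym (deriveM (di x Ux) (ei x Ux)).
Qed.

(** The derivative of $1/f$ is $-f^{-1}f^{-1}\partial_i f$, a product of functions already of class
    $C^k$ by induction. *)
Lemma Ck_onV k U f : open U -> (forall x, U x -> f x != 0) -> Ck_on k U f ->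
  Ck_on k U (fun x => (f x)^-1).
Proof.
move=> oU f0; elim: k => [|k IH] sf; have [cf df] := sf.
  by split=> // x Ux; apply: continuousV; [exact: f0|exact: cf].
split; first by move=> x Ux; apply: continuousV; [exact: f0|exact: cf].
move=> i; have [di Di] := df i; split.
  by move=> x Ux; apply: derivableV; [exact: f0|exact: di].
have Vf := IH (Ck_onS sf).
have C := Ck_onM oU (Ck_on_cst k U (-1)) (Ck_onM oU (Ck_onM oU Vf Vf) Di).
apply: (Ck_on_eq oU _ C) => x Ux.
rewrite /partial deriveV; [|exact: f0|exact: di].
by rewrite expr2 invfM mulN1r -mulNr.
Qed.

Lemma smooth_on_eq U f h : open U -> (forall y, U y -> f y = h y) ->
  smooth_on U f -> smooth_on U h.
Proof. by move=> oU fh sf k; apply: Ck_on_eq fh (sf k). Qed.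

Lemma smooth_on_cst U c : smooth_on U (fun=> c).
Proof. by move=> k; apply: Ck_on_cst. Qed.

Lemma smooth_onD U f h : open U -> smooth_on U f -> smooth_on U h ->
  smooth_on U (fun x => f x + h x).
Proof. by move=> oU sf sh k; apply: Ck_onD. Qed.

Lemma smooth_onM U f h : open U -> smooth_on U f -> smooth_on U h ->
  smooth_on U (fun x => f x * h x).
Proof. by move=> oU sf sh k; apply: Ck_onM. Qed.

Lemma smooth_onV U f : open U -> (forall x, U x -> f x != 0) ->
  smooth_on U f -> smooth_on U (fun x => (f x)^-1).
Proof. by move=> oU f0 sf k; apply: Ck_onV. Qed.

Lemma smooth_onN U f : open U -> smooth_on U f -> smooth_on U (fun x => - f x).
Proof.
move=> oU sf; apply: (smooth_on_eq oU (f := fun x => -1 * f x)).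
  by move=> y _; rewrite mulN1r.
by apply: smooth_onM => //; apply: smooth_on_cst.
Qed.

Lemma smooth_onB U f h : open U -> smooth_on U f -> smooth_on U h ->
  smooth_on U (fun x => f x - h x).
Proof. by move=> oU sf sh; apply: smooth_onD => //; apply: smooth_onN. Qed.

Lemma smooth_on_sum U (I : Type) (r : seq I) (P : pred I)
    (F : I -> coords -> R) : open U ->
  (forall i, P i -> smooth_on U (F i)) ->
  smooth_on U (fun x => \sum_(i <- r | P i) F i x).
Proof.
move=> oU sF; elim: r => [|i r IH].
  by apply: (smooth_on_eq oU _ (smooth_on_cst U 0)) => y _; rewrite big_nil.
have [Pi|nPi] := boolP (P i); last first.
  by apply: (smooth_on_eq oU _ IH) => y _; rewrite big_cons (negbTE nPi).
apply: (smooth_on_eq oU _ (smooth_onD oU (sF i Pi) IH)) => y _.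
by rewrite big_cons Pi.
Qed.

Lemma smooth_on_prod U (I : Type) (r : seq I) (P : pred I)
    (F : I -> coords -> R) : open U ->
  (forall i, P i -> smooth_on U (F i)) ->
  smooth_on U (fun x => \prod_(i <- r | P i) F i x).
Proof.
move=> oU sF; elim: r => [|i r IH].
  by apply: (smooth_on_eq oU _ (smooth_on_cst U 1)) => y _; rewrite big_nil.
have [Pi|nPi] := boolP (P i); last first.
  by apply: (smooth_on_eq oU _ IH) => y _; rewrite big_cons (negbTE nPi).
apply: (smooth_on_eq oU _ (smooth_onM oU (sF i Pi) IH)) => y _.
by rewrite big_cons Pi.
Qed.

Lemma smooth_on_partial U f i : smooth_on U f -> smooth_on U (partial i f).
Proof. by move=> sf k; have [_ /(_ i)[]] := sf k.+1. Qed.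

Lemma smooth_on_derivable U f i x : smooth_on U f -> U x ->
  derivable f x (delta_mx 0 i).
Proof. by move=> sf; have [_ /(_ i)[+ _]] := sf 1; apply. Qed.

Lemma smooth_on_det U m (A : coords -> 'M[R]_m) : open U ->
  (forall i j, smooth_on U (fun x => A x i j)) ->
  smooth_on U (fun x => \det (A x)).
Proof.
move=> oU sA; rewrite /determinant; apply: smooth_on_sum => // s _.
apply: smooth_onM => //; first exact: smooth_on_cst.
exact: smooth_on_prod.
Qed.

(** Cramer's rule: each entry is a cofactor divided by the determinant, and both are polynomial in
    the entries of [A]. The formula is used on [U] only, since [invmx] returns its argument on
    singular matrices. *)
Lemma smooth_on_invmx U m (A : coords -> 'M[R]_m) : open U ->
  (forall i j, smooth_on U (fun x => A x i j)) ->
  (forall x, U x -> A x \in unitmx) ->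
  forall i j, smooth_on U (fun x => invmx (A x) i j).
Proof.
move=> oU sA uA i j.
apply: (smooth_on_eq oU (f := fun x => (\det (A x))^-1 * cofactor (A x) j i)).
  by move=> y Uy; rewrite /invmx uA// !mxE.
apply: smooth_onM => //.
  apply: smooth_onV => //; last exact: smooth_on_det.
  by move=> y /uA; rewrite unitmxE unitfE.
apply: smooth_onM => //; first exact: smooth_on_cst.
apply: smooth_on_det => // a b.
by apply: (smooth_on_eq oU _ (sA _ _)) => y _; rewrite !mxE.
Qed.

Lemma partialM f h i x : derivable f x (delta_mx 0 i) ->
  derivable h x (delta_mx 0 i) ->
  partial i (fun y => f y * h y) x = partial i f x * h x + f x * partial i h x.
Proof.
by move=> df dh; rewrite /partial [LHS]deriveM// addrC [h x *: _]mulrC.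
Qed.

Lemma partial_sum m (F : 'I_m -> coords -> R) i x :
  (forall a, derivable (F a) x (delta_mx 0 i)) ->
  partial i (fun y => \sum_a F a y) x = \sum_a partial i (F a) x.
Proof.
move=> dF; rewrite /partial -derive_sum//; congr ('D__ _ x).
by apply/funext => y; rewrite fct_sumE.
Qed.

End Smooth.

(** * Contractions as traces, and nondegeneracy of Lorentz matrices *)

Lemma mxtrace_mul_tr (R : pzSemiRingType) m n (A B : 'M[R]_(m, n)) :
  \tr (A *m B^T) = \sum_i \sum_j A i j * B i j.
Proof.
by apply: eq_bigr => i _; rewrite mxE; apply: eq_bigr => j _; rewrite mxE.
Qed.

Lemma minkowski_unit (R : realType) : Defs.minkowski R \in unitmx.
Proof.
suff /mulmx1_unit[] : Defs.minkowski R *m Defs.minkowski R = 1%:M by [].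
apply/matrixP => i j; rewrite !mxE (bigD1 i)//= big1.
  rewrite !mxE eqxx; case: (i == j); rewrite ?mulr0 ?addr0//.
  by case: (i == 0); rewrite ?mulrNN mulr1.
by move=> a ai; rewrite !mxE eq_sym (negbTE ai) mul0r.
Qed.

(** [G] is a factor of a product equal to the Minkowski matrix, which is its own inverse. *)
Lemma lorentz_signature_unit (R : realType) (G : 'M[R]_4) :
  lorentz_signature G -> G \in unitmx.
Proof.
case=> _ [P uP PGP]; have := minkowski_unit R.
by rewrite -PGP !unitmx_mul => /andP[/andP[]].
Qed.

(** * Levi-Civita calculus in a single chart *)

Section LeviCivita.
Context {R : realType}.
Local Notation coords := 'rV[R]_4.
Variables (U : set coords) (g : coords -> 'M[R]_4).
Hypothesis oU : open U.
Hypothesis g_smooth : forall i j, smooth_on U (fun x => g x i j).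
Hypothesis g_sym : forall x, U x -> (g x)^T = g x.
Hypothesis g_unit : forall x, U x -> g x \in unitmx.

(** Smoothness is carried from the metric up to $s$ and $T$, because the rules for [partial] of
    sums, products and opposites require derivability. *)
Lemma smooth_on_inverse_metric i j : smooth_on U (inverse_metric g i j).
Proof. exact: smooth_on_invmx. Qed.

Lemma smooth_on_christoffel k i j : smooth_on U (christoffel g k i j).
Proof.
apply: smooth_onM => //; first exact: smooth_on_cst.
apply: smooth_on_sum => // l _; apply: smooth_onM => //.
  exact: smooth_on_inverse_metric.
by apply: smooth_onB => //; [apply: smooth_onD => //|];
  apply: smooth_on_partial.
Qed.

Lemma smooth_on_nabla_vector X : (forall k, smooth_on U (X k)) ->
  forall k i, smooth_on U (nabla_vector g X k i).
Proof.
move=> sX k i; apply: smooth_onD => //; first exact: smooth_on_partial.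
apply: smooth_on_sum => // m _; apply: smooth_onM => //.
exact: smooth_on_christoffel.
Qed.

Lemma smooth_on_nabla_mixed S : (forall k j, smooth_on U (S k j)) ->
  forall k j i, smooth_on U (nabla_mixed g S k j i).
Proof.
move=> sS k j i; apply: smooth_onB => //; first apply: smooth_onD => //.
- exact: smooth_on_partial.
- apply: smooth_on_sum => // m _; apply: smooth_onM => //.
  exact: smooth_on_christoffel.
- apply: smooth_on_sum => // m _; apply: smooth_onM => //.
  exact: smooth_on_christoffel.
Qed.

Lemma smooth_on_curvature k l i j : smooth_on U (curvature g k l i j).
Proof.
by apply: smooth_onB => //; apply: smooth_on_nabla_mixed => a b;
  apply: smooth_on_nabla_vector => c; apply: smooth_on_cst.
Qed.

Lemma smooth_on_ricci i j : smooth_on U (ricci g i j).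
Proof. by apply: smooth_on_sum => // k _; apply: smooth_on_curvature. Qed.

Lemma smooth_on_scalar_curvature : smooth_on U (scalar_curvature g).
Proof.
apply: smooth_on_sum => // i _; apply: smooth_on_sum => // j _.
by apply: smooth_onM => //; [exact: smooth_on_inverse_metric|
  exact: smooth_on_ricci].
Qed.

Lemma smooth_on_energy_momentum i j : smooth_on U (energy_momentum g i j).
Proof.
apply: smooth_onB => //; first exact: smooth_on_ricci.
do 2 apply: smooth_onM => //; first exact: smooth_on_cst.
exact: smooth_on_scalar_curvature.
Qed.

(** This is $\nabla_k g_{ij}=0$ written out. Lowering the upper index of each Christoffel symbol
    leaves half of three derivatives of the metric. Exchanging $i$ and $j$ flips the sign of two of
    them, so only $\partial_k g_{ij}$ survives in the sum. *)
Lemma metric_compatibility k i j x : U x ->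
  partial k (fun y => g y i j) x =
  \sum_m christoffel g m k i x * g x m j
  + \sum_m christoffel g m k j x * g x i m.
Proof.
move=> Ux.
have gC a b : g x a b = g x b a by rewrite -[in LHS]g_sym// mxE.
have pC c a b : partial c (fun y => g y a b) x = partial c (fun y => g y b a) x.
  by apply: (eq_partial _ oU Ux) => y Uy; rewrite -[in LHS]g_sym// mxE.
have Vg l b : \sum_m inverse_metric g m l x * g x m b = (b == l)%:R.
  have /matrixP/(_ b l) := mulmxV (g_unit Ux); rewrite !mxE => <-.
  by apply: eq_bigr => m _; rewrite mulrC gC.
(* These are the Christoffel symbols of the first kind. *)
have lower a b : \sum_m christoffel g m k a x * g x m b =
    2^-1 * (partial k (fun y => g y b a) x + partial a (fun y => g y k b) x
            - partial b (fun y => g y k a) x).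
  under eq_bigr do rewrite /christoffel -mulrA mulr_suml.
  rewrite -mulr_sumr exchange_big /=; congr (_ * _).
  under eq_bigr do under eq_bigr do rewrite mulrAC.
  under eq_bigr do rewrite -mulr_suml Vg.
  rewrite (bigD1 b)//= [X in _ + X]big1 ?addr0 ?eqxx ?mul1r// => l lb.
  by rewrite eq_sym (negbTE lb) mul0r.
under [X in _ + X]eq_bigr do rewrite gC.
by rewrite !lower (pC k j i); field.
Qed.

(** Differentiating $g^{-1}g=1$ gives $\partial_k(g^{-1})\,g=-g^{-1}\,\partial_k g$; then multiply
    by $g^{-1}$ on the right. *)
Lemma partial_inverse_metric k x : U x ->
  \matrix_(i, j) partial k (inverse_metric g i j) x =
  - (invmx (g x) *m (\matrix_(i, j) partial k (fun y => g y i j) x)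
     *m invmx (g x)).
Proof.
move=> Ux; set D := (LHS); set A := \matrix_(i, j) _.
suff DG : D *m g x = - (invmx (g x) *m A).
  by rewrite -[D](mulmxK (g_unit Ux)) DG mulNmx.
apply/eqP; rewrite -addr_eq0; apply/eqP/matrixP => i j.
have S0 : partial k (fun y => \sum_m inverse_metric g i m y * g y m j) x = 0.
  transitivity (partial k (fun=> (i == j)%:R : R) x); last exact: derive_cst.
  apply: (eq_partial _ oU Ux) => y Uy; have := mulVmx (g_unit Uy).
  by move=> /matrixP/(_ i j); rewrite !mxE.
have dV m := smooth_on_derivable (i := k) (smooth_on_inverse_metric i m) Ux.
have dg m := smooth_on_derivable (i := k) (g_smooth m j) Ux.
rewrite [RHS]mxE -[RHS]S0 partial_sum; last by move=> m; apply: derivableM.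
rewrite !mxE -big_split /=; apply: eq_bigr => m _.
by rewrite partialM// !mxE.
Qed.

(** With $k$ fixed, everything becomes matrix algebra. Put $H=g^{-1}$ and let $C$ have entry
    $\Gamma^m_{ki}$ in row $i$, column $m$. Then $\nabla_kT=\partial_kT-CT-TC^T$, and the two
    correction terms, contracted with $H$, are exactly what $\partial_kH$ contributes to the Leibniz
    rule. *)
Lemma trace_nabla_covariant T k x : (forall i j, smooth_on U (T i j)) -> U x ->
  \sum_i \sum_j inverse_metric g i j x * nabla_covariant g T k i j x =
  partial k (fun y => \sum_i \sum_j inverse_metric g i j y * T i j y) x.
Proof.
move=> sT Ux.
have dV i j := smooth_on_derivable (i := k) (smooth_on_inverse_metric i j) Ux.
have dT i j := smooth_on_derivable (i := k) (sT i j) Ux.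
have dVT i j : derivable (fun y => inverse_metric g i j y * T i j y) x
    (delta_mx 0 k) by apply: derivableM.
have sVT i j : smooth_on U (fun y => inverse_metric g i j y * T i j y).
  by apply: smooth_onM => //; exact: smooth_on_inverse_metric.
rewrite partial_sum; last first.
  by move=> i; apply: smooth_on_derivable Ux; apply: smooth_on_sum.
under [RHS]eq_bigr do rewrite partial_sum//.
under [RHS]eq_bigr do under eq_bigr do rewrite partialM//.
pose H := invmx (g x); pose Tx := \matrix_(i, j) T i j x.
pose C := \matrix_(i, m) christoffel g m k i x.
pose dH := \matrix_(i, j) partial k (inverse_metric g i j) x.
pose dTx := \matrix_(i, j) partial k (T i j) x.
have gE : \matrix_(i, j) partial k (fun y => g y i j) x =
    C *m g x + g x *m C^T.
  apply/matrixP => i j; rewrite !mxE metric_compatibility//.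
  congr (_ + _); apply: eq_bigr => m _; rewrite !mxE//.
  by rewrite mulrC.
(* The inverse metric is parallel too: substitute [gE] into $-H\,(\partial_k g)\,H$ and cancel
   $Hg=gH=1$. *)
have dHE : dH = - (H *m C + C^T *m H).
  rewrite /dH partial_inverse_metric// gE mulmxDr mulmxDl !mulmxA.
  by rewrite mulVmx ?g_unit// mul1mx -!mulmxA mulmxV ?g_unit// mulmx1.
have -> : \sum_i \sum_j inverse_metric g i j x * nabla_covariant g T k i j x =
    \tr (H *m (dTx - C *m Tx - Tx *m C^T)^T).
  rewrite mxtrace_mul_tr; apply: eq_bigr => i _; apply: eq_bigr => j _.
  rewrite !mxE; congr (_ * (_ - _ - _)); apply: eq_bigr => m _.
    by rewrite !mxE.
  by rewrite !mxE mulrC.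
have -> : \sum_i \sum_j (partial k (inverse_metric g i j) x * T i j x +
      inverse_metric g i j x * partial k (T i j) x) =
    \tr (dH *m Tx^T) + \tr (H *m dTx^T).
  rewrite !mxtrace_mul_tr -big_split; apply: eq_bigr => i _.
  by rewrite -big_split; apply: eq_bigr => j _; rewrite !mxE.
have trmxB (A B : 'M[R]_4) : (A - B)^T = A^T - B^T.
  by apply/matrixP => a b; rewrite !mxE.
rewrite dHE !trmxB !trmx_mul trmxK !mulmxBr.
rewrite mulNmx mulmxDl !raddfB raddfN raddfD /= !mulmxA.
(* Cyclicity of the trace turns $\mathrm{tr}(HT^TC^T)$ into $\mathrm{tr}(C^THT^T)$, after which both
   sides have the same terms. *)
by rewrite (mxtrace_mulC _ C^T) mulmxA; ring.
Qed.

Lemma trace_energy_momentum x : U x ->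
  \sum_i \sum_j inverse_metric g i j x * energy_momentum g i j x =
  - scalar_curvature g x.
Proof.
move=> Ux; have gC a b : g x a b = g x b a by rewrite -[in LHS]g_sym// mxE.
under eq_bigr do under eq_bigr do rewrite mulrBr mulrCA.
under eq_bigr do rewrite sumrB -mulr_sumr.
rewrite sumrB -mulr_sumr -/(scalar_curvature g x).
(* By symmetry of $g$ this is $\mathrm{tr}(g^{-1}g)$, the dimension. *)
have -> : \sum_i \sum_j inverse_metric g i j x * g x i j = 4%:R.
  have /(congr1 mxtrace) := mulVmx (g_unit Ux); rewrite mxtrace1 => <-.
  by apply: eq_bigr => i _; rewrite mxE; apply: eq_bigr => j _; rewrite gC.
by field.
Qed.

End LeviCivita.

Theorem theorem5 (R : realType) (M : smooth_manifold4 R)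
    (g : lorentz_metric M) :
  in_class_Omega1_Omega2 g <-> constant_scalar_curvature g.
Proof.
(* Both implications follow from the pointwise identity $g^{ij}\nabla_kT_{ij}=-\partial_k s$ in each
   chart. *)
suff E phi : atlas phi -> forall x, chart_img phi x -> forall k : 'I_4,
    \sum_i \sum_j inverse_metric (metric_comp g phi) i j x *
      nabla_covariant (metric_comp g phi)
        (energy_momentum (metric_comp g phi)) k i j x =
    - partial k (scalar_curvature (metric_comp g phi)) x.
  split=> h phi aphi x Ux k; last by rewrite /= E// h// oppr0.
  by apply/eqP; rewrite -oppr_eq0 -E//; apply/eqP/h.
move=> aphi x Ux k; have oU := @chart_img_open R M phi.
have gs := metric_smooth g aphi.
have gsym y : chart_img phi y -> (metric_comp g phi y)^T = metric_comp g phi y.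
  by move=> /(metric_signature g aphi)[].
have gu y : chart_img phi y -> metric_comp g phi y \in unitmx.
  by move=> /(metric_signature g aphi); apply: lorentz_signature_unit.
rewrite (trace_nabla_covariant oU gs gsym gu _ _ Ux); last first.
  exact: smooth_on_energy_momentum.
(* The trace identity holds throughout the open chart image, so it may be differentiated at [x]. *)
transitivity (partial k (fun y => - scalar_curvature (metric_comp g phi) y) x).
  by apply: (eq_partial _ oU Ux) => y; apply: trace_energy_momentum.
rewrite [LHS]deriveN//.
exact: smooth_on_derivable (smooth_on_scalar_curvature oU gs gu) Ux.
Qed.
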